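(* Let $n\ge 5$ be an integer and let $G$ be a simple graph. Then $G\in\mathcal{G}(n,n-2)$ if and only if $G\cong G(n,n-3)$ when $n$ is odd, and $G\cong G(n,n-4)$ or $G\cong G(n,2)$ when $n$ is even.
   Context: All graphs are finite and simple. The spectral radius $\rho(G)$ of a graph $G$ is the largest eigenvalue of its adjacency matrix. A graph is nonregular if not all its vertices have the same degree. For integers $n$ and $\Delta$, $\mathcal{G}(n,\Delta)$ denotes the set of connected nonregular graphs of order $n$ with maximum degree $\Delta$ whose spectral radius is maximum among all connected nonregular graphs of order $n$ with maximum degree $\Delta$. For an even integer $t$, $K_t-M_{t/2}$ denotes the graph obtained from the complete graph $K_t$ by deleting the edges of a perfect matching. For even $t$ with $1\le t\le n-2$, $G(n,t)$ is the graph of order $n$ obtained from the disjoint union of a single vertex $u$, a copy of $K_t-M_{t/2}$ and a copy of the complete graph $K_{n-t-1}$ by adding all edges between $u$ and the vertices of $K_t-M_{t/2}$, and all edges between the vertices of $K_t-M_{t/2}$ and the vertices of $K_{n-t-1}$ (and no other edges). *)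

(* Defs.v *)
From mathcomp Require Import all_boot all_order all_algebra.
From mathcomp Require Import classical_sets reals.
From mathcomp Require Import complex polyrcf.

Set Implicit Arguments.
Unset Strict Implicit.
Unset Printing Implicit Defensive.

Import Order.TTheory GRing.Theory Num.Theory.
Local Open Scope ring_scope.

Record sgraph := SGraph {
  vertex :> finType;
  edge : rel vertex;
  edge_sym : symmetric edge;
  edge_irrefl : irreflexive edge
}.

Definition degree (G : sgraph) (x : G) : nat := #|[set y | edge x y]|.

Definition max_degree (G : sgraph) : nat := (\max_(x : G) degree x)%N.

Definition nonregular (G : sgraph) : Prop :=
  exists x y : G, degree x <> degree y.

Definition connected (G : sgraph) : Prop :=
  forall x y : G, connect (@edge G) x y.

Definition isomorphic (G H : sgraph) : Prop :=
  exists2 f : G -> H, bijective f & forall x y, edge (f x) (f y) = edge x y.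

Definition adjmx (R : nzRingType) (G : sgraph) : 'M[R]_#|G| :=
  \matrix_(i, j) (edge (enum_val i) (enum_val j))%:R.

Definition is_largest_eigenvalue (R : realType) (n : nat) (A : 'M[R]_n)
    (r : R) : Prop :=
  eigenvalue A r /\ forall s, eigenvalue A s -> s <= r.

(* The default 0 is used only for the graph with no vertices, see
   [spectral_radiusP]. *)
Definition spectral_radius (R : realType) (G : sgraph) : R :=
  xget 0 [set r | is_largest_eigenvalue (adjmx R G) r]%classic.

Definition candidate (n Delta : nat) (G : sgraph) : Prop :=
  [/\ connected G, nonregular G, #|G| = n & max_degree G = Delta].

(* Membership in the class G(n, Delta) of the connected nonregular graphs of
   order n and maximum degree Delta with maximum spectral radius. *)
Definition extremal (R : realType) (n Delta : nat) (G : sgraph) : Prop :=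
  candidate n Delta G /\
  forall H : sgraph, candidate n Delta H ->
    spectral_radius R H <= spectral_radius R G.

(* For even t this is the perfect matching {0,1}, {2,3}, ... of K_t. *)
Definition matching_edge (t : nat) : rel 'I_t :=
  fun i j => (i != j) && (i./2 == j./2).

(* The first summand is u, the second K_t - M_(t/2), the third K_(n-t-1). *)
Definition Gnt_vertex (n t : nat) : finType := (unit + 'I_t + 'I_(n - t - 1))%type.

Definition Gnt_edge (n t : nat) : rel (Gnt_vertex n t) := fun x y =>
  match x, y with
  | inl (inl _), inl (inl _) => false
  | inl (inl _), inl (inr _) | inl (inr _), inl (inl _) => true
  | inl (inl _), inr _       | inr _, inl (inl _)       => false
  | inl (inr i), inl (inr j) => (i != j) && ~~ matching_edge i j
  | inl (inr _), inr _       | inr _, inl (inr _)       => true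
  | inr i, inr j => i != j
  end.

Fact Gnt_edge_sym n t : symmetric (@Gnt_edge n t).
Proof.
move=> [[[]|i]|i] [[[]|j]|j] //=; rewrite /matching_edge ?[j == i]eq_sym //.
by rewrite [j./2 == _]eq_sym.
Qed.

Fact Gnt_edge_irrefl n t : irreflexive (@Gnt_edge n t).
Proof. by move=> [[[]|i]|i] //=; rewrite eqxx. Qed.

Definition Gnt (n t : nat) : sgraph :=
  SGraph (@Gnt_edge_sym n t) (@Gnt_edge_irrefl n t).

Lemma adjmx_sym (R : nzRingType) (G : sgraph) : (adjmx R G)^T = adjmx R G.
Proof. by apply/matrixP=> i j; rewrite !mxE edge_sym. Qed.

Lemma sym_real_eigenvalue (R : rcfType) (n : nat) (A : 'M[R]_n) :
  (0 < n)%N -> A^T = A -> exists a, eigenvalue A a.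
Proof.
move=> n_gt0 symA; pose AC := map_mx (real_complex R) A.
have /closed_rootP[z] : size (char_poly AC) != 1.
  by rewrite size_char_poly eqSS -lt0n.
rewrite -eigenvalue_root_char => /eigenvalueP[v vA vn0].
pose x := map_mx (@complex.Re R) v; pose y := map_mx (@complex.Im R) v.
pose a := complex.Re z; pose b := complex.Im z.
have ReS : {morph @complex.Re R : u w / u + w} by move=> [? ?] [? ?].
have ImS : {morph @complex.Im R : u w / u + w} by move=> [? ?] [? ?].
have xA : x *m A = a *: x - b *: y.
  apply/rowP=> j; move/rowP/(_ j)/(congr1 (@complex.Re R)): vA.
  rewrite !mxE (big_morph _ ReS (erefl _)) => vA.
  transitivity (complex.Re (z * v 0 j)).
    rewrite -vA; apply: eq_bigr => i _; rewrite !mxE.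
    by case: (v 0 i) => p q /=; rewrite mulr0 subr0.
  by rewrite /a /b; case: (z) => ? ?; case: (v 0 j).
have yA : y *m A = a *: y + b *: x.
  apply/rowP=> j; move/rowP/(_ j)/(congr1 (@complex.Im R)): vA.
  rewrite !mxE (big_morph _ ImS (erefl _)) => vA.
  transitivity (complex.Im (z * v 0 j)).
    rewrite -vA; apply: eq_bigr => i _; rewrite !mxE.
    by case: (v 0 i) => p q /=; rewrite mulr0 add0r.
  by rewrite /a /b; case: (z) => ? ?; case: (v 0 j).
have sq_ge0 (w : 'rV[R]_n) : 0 <= (w *m w^T) 0 0.
  by rewrite mxE sumr_ge0 // => i _; rewrite mxE -expr2 sqr_ge0.
have sq_eq0 (w : 'rV[R]_n) : (w *m w^T) 0 0 = 0 -> w = 0.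
  rewrite mxE => /psumr_eq0P w0; apply/rowP => i; rewrite mxE.
  have /eqP := w0 (fun i _ => ltac:(by rewrite mxE -expr2 sqr_ge0)) i isT.
  by rewrite mxE -expr2 sqrf_eq0 => /eqP.
have xy0 : ~ (x = 0 /\ y = 0).
  move=> [x0 y0]; move/eqP: vn0; apply; apply/rowP=> j.
  move/rowP/(_ j): x0; move/rowP/(_ j): y0; rewrite !mxE.
  by case: (v 0 j) => ? ? /= -> ->.
have : x *m A *m y^T = (y *m A *m x^T)^T.
  by rewrite !trmx_mul !trmxK symA mulmxA.
rewrite xA yA mulmxBl mulmxDl -!scalemxAl linearD !linearZ /= !trmx_mul !trmxK.
move/addrI/eqP; rewrite scalerN eq_sym -subr_eq0 opprK -scalerDr => /eqP.
move/matrixP/(_ 0 0); rewrite mxE [X in _ * X]mxE [RHS]mxE => /eqP.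
rewrite mulf_eq0 paddr_eq0 // => /orP[/eqP b0|/andP[/eqP/sq_eq0 x0 /eqP/sq_eq0 y0]];
  last by case: xy0.
exists a; have [x0|xn0] := eqVneq x 0.
  apply/eigenvalueP; exists y; first by rewrite yA b0 scale0r addr0.
  by apply/eqP => y0; case: xy0.
by apply/eigenvalueP; exists x; rewrite // xA b0 scale0r subr0.
Qed.

Lemma spectral_radiusP (R : realType) (G : sgraph) : (0 < #|G|)%N ->
  is_largest_eigenvalue (adjmx R G) (spectral_radius R G).
Proof.
move=> G_gt0; set A := adjmx R G.
have [a Aa] := sym_real_eigenvalue G_gt0 (adjmx_sym R G).
have p0 : char_poly A != 0 by rewrite monic_neq0 ?char_poly_monic.
pose s := rootsR (char_poly A).
have sE b : (b \in s) = eigenvalue A b.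
  by rewrite -(roots_on_rootsR p0) inE eigenvalue_root_char.
apply: (@xgetPex _ 0 [set r | is_largest_eigenvalue A r]%classic).
pose m := \big[Order.max/a]_(b <- s) b.
exists m; split; last by move=> b; rewrite -sE => bs; apply: le_bigmax_seq bs _.
rewrite /m big_seq; elim/big_ind: _ => [//|b c Ab Ac|b]; last by rewrite sE.
by case: (leP b c).
Qed.

(* Main.v *)
Require Import Defs.
From mathcomp Require Import all_boot all_order all_algebra.
From mathcomp Require Import classical_sets reals.
From mathcomp Require Import complex ring lra zify.

(* Let d(v) be the degree of v in the complement of a connected nonregular graph
   of order n and maximum degree n - 2, so that 1 <= d(v) <= n - 2. Put
   p = rho + 1 and let x be the Perron vector with entries summing to 1. The
   eigenvalue equation reads p x(v) + (sum of x over the non-neighbours of v) = 1.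
   Summing it over v gives n - 1 - p = sum_v (d(v) - 1) x(v), and applying it
   twice gives (p^2 - d(v)) x(v) >= p - d(v). Together they yield
     (n - 1 - p) (p^2 - 1) >= (d(v) - 1) (n - 1 - d(v))   for every v,
   which for d(v) >= 2 is an equality exactly when v is the only such vertex, that is
   when the complement is a star with a = d(v) leaves plus a matching and the graph
   is G(n, n - 1 - a). For p > n - 2 the left-hand side decreases in p, so rho is
   largest when it is smallest. As n - 1 - a is even, the minimum is reached at
   a = 2 for n odd, and at a = 3 and a = n - 3 for n even; when n is even two or
   more vertices with d = 2 or d = n - 2 have to be excluded by summing their
   contributions to n - 1 - p. *)

Set Implicit Arguments.
Unset Strict Implicit.
Unset Printing Implicit Defensive.

Import Order.TTheory GRing.Theory Num.Theory.
Local Open Scope ring_scope.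

Local Open Scope sesquilinear_scope.

(** * Rayleigh quotients of real symmetric matrices *)

(** Over the complex numbers [A] is Hermitian, hence unitarily diagonalizable with real eigenvalues.
    In the coordinates [z] of [x] in the eigenbasis, the two forms are the sums of d_i |z_i|^2 and
    of |z_i|^2, and each d_i is at most [r]. *)
Lemma rayleigh_le (R : rcfType) n (A : 'M[R]_n) (r : R) : A^T = A ->
  (forall s, eigenvalue A s -> s <= r) ->
  forall x : 'rV_n, (x *m A *m x^T) 0 0 <= r * (x *m x^T) 0 0.
Proof.
move=> symA r_max x; pose f := real_complex R.
pose AC := map_mx f A; pose P := spectralmx AC; pose D := spectral_diag AC.
have conjf (a : R) : (f a)^* = f a by exact: conjc_real.
have ACh : AC \is hermsymmx.
  apply: realsym_hermsym; first by apply/is_hermitianmxP;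
    rewrite expr0 scale1r map_mx_id // /AC map_trmx symA.
  by apply/mxOverP => i j; rewrite mxE; apply/complex_realP; exists (A i j).
have Pu : P \is unitarymx by exact: spectral_unitarymx.
have /orthomx_spectralP : AC \is normalmx by exact: hermitian_normalmx.
rewrite -/P -/D => ACE.
have PAC : P *m AC = diag_mx D *m P.
  by rewrite {1}ACE !mulmxA mulmxV ?mul1mx // unitarymx_unit.
have D_real i : exists2 d, D 0 i = f d & d <= r.
  have /mxOverP/(_ 0 i) /complex_realP[d Dd] := hermitian_spectral_diag_real ACh.
  (* The embedding [f] preserves and reflects eigenvalues, so a real eigenvalue of [AC] is one of
     [A]. *)
  exists d => //; apply: r_max; rewrite -(eigenvalue_map f).
  suff : eigenvalue AC (D 0 i) by rewrite Dd.
  apply/eigenvalueP; exists (row i P).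
    by rewrite -row_mul PAC; apply/rowP=> j; rewrite mul_diag_mx !mxE.
  apply/eqP => P0; have /row_unitarymxP/(_ i i) := Pu.
  by rewrite P0 linear0l eqxx => /eqP; rewrite eq_sym oner_eq0.
pose xC := map_mx f x; pose z := xC *m (P ^t* ).
have Px : P *m xC^T = z ^t*.
  rewrite /z trmx_mul map_mxM trmxCK; congr (_ *m _).
  by apply/matrixP => i j; rewrite !mxE; exact: esym (conjf _).
have qE (B : 'M[R]_n) : f ((x *m B *m x^T) 0 0) = (xC *m map_mx f B *m xC^T) 0 0.
  by rewrite /xC map_trmx -!map_mxM [RHS]mxE.
have := qE A; have := qE 1%:M; rewrite -/AC mulmx1.
move: ((x *m A *m x^T) 0 0) ((x *m x^T) 0 0) => a b.
have -> : xC *m map_mx f 1%:M *m xC^T = z *m z ^t*.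
  rewrite -Px /z map_mx1 mulmx1 -mulmxA [_ *m (P *m _)]mulmxA -invmx_unitary //.
  by rewrite mulVmx ?mul1mx // unitarymx_unit.
rewrite ACE invmx_unitary // !mulmxA -/z -(mulmxA _ P) Px.
rewrite [in RHS]mxE => bE; rewrite [in RHS]mxE => aE; rewrite -lecR.
have -> : (r * b)%:C%C = f r * f b by rewrite -rmorphM.
rewrite [X in X <= _]aE bE mulr_sumr; apply: ler_sum => i _.
rewrite mul_mx_diag !mxE; have [d -> dr] := D_real i.
by rewrite mulrAC mulrC ler_wpM2r ?mul_conjC_ge0 // lecR.
Qed.

(** The form [q] of [B] = r - A is positive semidefinite and vanishes at [y]. So [y] minimizes it,
    and its gradient there, a multiple of [y *m B], must vanish. *)
Lemma rayleigh_eq (R : rcfType) n (A : 'M[R]_n) (r : R) (y : 'rV_n) : A^T = A ->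
  (forall s, eigenvalue A s -> s <= r) ->
  r * (y *m y^T) 0 0 <= (y *m A *m y^T) 0 0 -> y *m A = r *: y.
Proof.
move=> symA r_max y_max; pose B := r%:M - A.
have BT : B^T = B by rewrite /B linearB /= tr_scalar_mx symA.
have yAB : y *m A = r *: y - y *m B.
  by rewrite /B mulmxBr mul_mx_scalar opprB addrC subrK.
pose q (x : 'rV_n) := (x *m B *m x^T) 0 0.
have q_ge0 x : 0 <= q x.
  rewrite /q mulmxBr mulmxBl mxE [X in _ + X]mxE subr_ge0.
  by rewrite mul_mx_scalar -scalemxAl [leRHS]mxE rayleigh_le.
have qy0 : q y = 0.
  apply/eqP; rewrite eq_le q_ge0 andbT /q mulmxBr mulmxBl mxE [X in _ + X]mxE.
  by rewrite subr_le0 mul_mx_scalar -scalemxAl [leLHS]mxE.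
clearbody B; pose b := y *m B; pose N := (b *m b^T) 0 0.
have NE : N = \sum_i b 0 i ^+ 2.
  by rewrite /N mxE; apply: eq_bigr => i _; rewrite [X in _ * X]mxE -expr2.
have N_ge0 : 0 <= N by rewrite NE sumr_ge0 // => i _; rewrite sqr_ge0.
have qt t : q (y + t *: b) = 2 * t * N + t ^+ 2 * q b.
  have yBb : (y *m B *m b^T) 0 0 = N by [].
  have bBy : (b *m B *m y^T) 0 0 = N.
    by rewrite /N {2}/b trmx_mul BT mulmxA.
  have addE (M1 M2 : 'M[R]_1) : (M1 + M2) 0 0 = M1 0 0 + M2 0 0 by rewrite mxE.
  have mulE c (M1 : 'M[R]_1) : (c *: M1) 0 0 = c * M1 0 0 by rewrite mxE.
  have -> : q (y + t *: b) = ((y + t *: b) *m B *m (y^T + t *: b^T)) 0 0.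
    by congr ((_ *m _) 0 0); apply/matrixP => i j; rewrite !mxE.
  rewrite !mulmxDl !mulmxDr -!scalemxAr -!scalemxAl.
  rewrite !(addE, mulE) yBb bBy -!/(q _) qy0.
  ring.
have N0 : N = 0.
  have := q_ge0 b; rewrite le_eqVlt => /orP[/eqP qb0|qb_gt0].
    by have := q_ge0 (y + (-1) *: b); rewrite qt -qb0; lra.
  (* This t minimizes 2 t N + t^2 q(b); the minimum is - N^2 / q(b). *)
  have := q_ge0 (y + (- (N / q b)) *: b); rewrite qt.
  have -> : 2 * - (N / q b) * N + (- (N / q b)) ^+ 2 * q b = - (N ^+ 2 / q b).
    by field; rewrite gt_eqF.
  rewrite oppr_ge0 pmulr_lle0 ?invr_gt0 // => N2.
  by apply/eqP; rewrite -sqrf_eq0 eq_le N2 sqr_ge0.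
have b0 : b = 0.
  have /psumr_eq0P b0 : \sum_i b 0 i ^+ 2 = 0 by rewrite -NE.
  apply/rowP => i; rewrite [RHS]mxE; apply/eqP; rewrite -sqrf_eq0.
  by rewrite b0 // => j _; rewrite sqr_ge0.
by rewrite yAB -/b b0 subr0.
Qed.

(** * Perron vector and average degree *)

Section Perron.
Variables (R : realType) (G : sgraph).
Hypothesis G_gt0 : (0 < #|G|)%N.

(** Replacing an eigenvector for the largest eigenvalue by its entrywise absolute value keeps the
    norm and does not decrease the quadratic form, since the entries of [A] are nonnegative. By
    [rayleigh_eq] the result is again an eigenvector; it is then scaled to sum 1. *)
Lemma perron : exists x : G -> R,
  [/\ forall v, 0 <= x v, \sum_v x v = 1 &
      forall v, spectral_radius R G * x v = \sum_(w | edge v w) x w].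
Proof.
set r := spectral_radius R G; pose A := adjmx R G.
have [/eigenvalueP[u uA un0] r_max] := spectral_radiusP R G_gt0.
have symA : A^T = A by exact: adjmx_sym.
pose y : 'rV[R]_#|G| := map_mx Num.norm u.
have yA : y *m A = r *: y.
  apply: rayleigh_eq => //.
  have -> : (y *m y^T) 0 0 = (u *m u^T) 0 0.
    rewrite !mxE; apply: eq_bigr => i _.
    by rewrite !mxE -normrM -expr2 ger0_norm ?sqr_ge0.
  have -> : r * (u *m u^T) 0 0 = (u *m A *m u^T) 0 0.
    by rewrite uA -scalemxAl [RHS]mxE.
  rewrite !mxE; apply: ler_sum => j _; rewrite !mxE.
  apply: le_trans (ler_norm _) _; rewrite normrM ler_wpM2r //.
  apply: le_trans (ler_norm_sum _ _ _) _.
  apply: ler_sum => i _; rewrite !mxE normrM.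
  by rewrite [`|_%:R|]ger0_norm ?ler0n.
pose N := \sum_i y 0 i.
have N_gt0 : 0 < N.
  have y_ge0 i : 0 <= y 0 i by rewrite mxE.
  rewrite lt_neqAle sumr_ge0 // andbT eq_sym.
  apply: contra un0 => /eqP/psumr_eq0P yz; apply/eqP/rowP => i.
  have := yz (fun i _ => y_ge0 i) i isT.
  by rewrite !mxE => /eqP; rewrite normr_eq0 => /eqP.
exists (fun v => y 0 (enum_rank v) / N); split.
- by move=> v; apply: divr_ge0; [rewrite mxE | exact: ltW].
- rewrite -mulr_suml (reindex (@enum_val _ G)) /=; last exact/onW_bij/enum_val_bij.
  under eq_bigr do rewrite enum_valK.
  by rewrite divff // gt_eqF.
- move=> v; rewrite mulrA -mulr_suml; congr (_ / _).
  have /rowP/(_ (enum_rank v)) := yA; rewrite [X in _ = X -> _]mxE => <-.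
  rewrite mxE [RHS]big_mkcond [RHS](reindex (@enum_val _ G)) /=;
    last exact/onW_bij/enum_val_bij.
  apply: eq_bigr => i _; rewrite [A _ _]mxE enum_rankK enum_valK edge_sym.
  by case: ifP; rewrite ?mulr1 ?mulr0.
Qed.

(** This is the Rayleigh bound for the all-ones vector. *)
Lemma degree_sum_le :
  (\sum_(v : G) degree v)%:R <= spectral_radius R G * #|G|%:R.
Proof.
have [_ r_max] := spectral_radiusP R G_gt0.
have := rayleigh_le (adjmx_sym R G) r_max (const_mx 1).
congr (_ <= _ * _); last first.
  rewrite mxE; under eq_bigr do rewrite !mxE mulr1.
  by rewrite sumr_const card_ord.
rewrite mxE natr_sum [RHS](reindex (@enum_val _ G)) /=; last exact/onW_bij/enum_val_bij.
apply: eq_bigr => i _; rewrite [X in _ * X]mxE [X in _ * X]mxE mulr1 mxE.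
have -> : (degree (enum_val i))%:R = \sum_(w | edge (enum_val i) w) (1 : R).
  by rewrite /degree cardsE -sum1_card natr_sum.
rewrite [RHS]big_mkcond [RHS](reindex (@enum_val _ G)) /=;
  last exact/onW_bij/enum_val_bij.
apply: eq_bigr => j _; rewrite !mxE mul1r edge_sym.
by case: edge.
Qed.

End Perron.

(** * The complement graph and the eigenvalue equation in terms of it *)

Definition coedge (G : sgraph) : rel G := fun x y => (x != y) && ~~ edge x y.

Definition codeg (G : sgraph) (x : G) : nat := #|[set y | coedge x y]|.

Lemma coedge_sym (G : sgraph) : symmetric (@coedge G).
Proof. by move=> x y; rewrite /coedge eq_sym edge_sym. Qed.

Lemma edgeE (G : sgraph) (x y : G) : edge x y = (x != y) && ~~ coedge x y.
Proof.
rewrite /coedge negb_and !negbK; case: eqVneq => //= <-; exact: edge_irrefl.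
Qed.

Lemma degree_codeg (G : sgraph) (x : G) : (degree x + codeg x).+1 = #|G|.
Proof.
have xG : (0 < #|G|)%N by apply/card_gt0P; exists x.
have -> : (degree x + codeg x)%N = #|[set~ x]|; last by rewrite cardsC1 prednK.
rewrite -(cardsID [set y | edge x y] [set~ x]); congr (_ + _)%N;
  apply: eq_card => y; rewrite !inE; last by rewrite /coedge eq_sym andbC.
by case: eqVneq => [->|//]; rewrite edge_irrefl.
Qed.

Section PerronVector.
Variables (R : realFieldType) (G : sgraph) (p : R) (x : G -> R).
Hypotheses (x_ge0 : forall v, 0 <= x v) (x_sum : \sum_v x v = 1).
Hypothesis px : forall v, p * x v + \sum_(w | coedge v w) x w = 1.

Let codegE (v : G) (c : R) : \sum_(w | coedge v w) c = (codeg v)%:R * c.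
Proof.
rewrite sumr_const mulr_natl /codeg; congr (_ *+ _).
by apply: eq_card => w; rewrite !inE.
Qed.

Lemma codeg_sum : \sum_v ((codeg v)%:R - 1) * x v = #|G|%:R - 1 - p.
Proof.
have : \sum_v (p * x v + \sum_(w | coedge v w) x w) = #|G|%:R.
  by rewrite (eq_bigr (fun _ => 1)) ?sumr_const.
rewrite big_split /= -mulr_sumr x_sum mulr1.
have -> : \sum_v \sum_(w | coedge v w) x w = \sum_w (codeg w)%:R * x w.
  rewrite (exchange_big_dep xpredT) //=; apply: eq_bigr => w _.
  by rewrite -codegE; apply: eq_bigl => v; rewrite coedge_sym.
move=> <-; under eq_bigr do rewrite mulrBl mul1r.
by rewrite sumrB x_sum addrAC [p + _]addrC addrK.
Qed.

Lemma walk2 v :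
  p ^+ 2 * x v = p - (codeg v)%:R + \sum_(w | coedge v w) \sum_(u | coedge w u) x u.
Proof.
have -> : p ^+ 2 * x v = p - \sum_(w | coedge v w) p * x w.
  by rewrite -mulr_sumr -[p in p - _]mulr1 -(px v); ring.
have -> : \sum_(w | coedge v w) p * x w =
    \sum_(w | coedge v w) (1 - \sum_(u | coedge w u) x u).
  by apply: eq_bigr => w _; rewrite -(px w) addrK.
by rewrite sumrB codegE mulr1 opprB addrA addrAC.
Qed.

(** Every non-neighbour w of v has v among its own non-neighbours, so the double sum in [walk2]
    contains x(v) at least d(v) times. *)
Lemma walk2_ge v : p - (codeg v)%:R <= (p ^+ 2 - (codeg v)%:R) * x v.
Proof.
rewrite mulrBl walk2 -addrA lerDl subr_ge0 -codegE.
apply: ler_sum => w vw; rewrite (bigD1 v) 1?coedge_sym //= lerDl.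
by apply: sumr_ge0.
Qed.

(** If every non-neighbour w of v has v as its only non-neighbour, the double sum in [walk2] is
    exactly d(v) x(v). *)
Lemma walk2_eq v : (forall w, coedge v w -> codeg w = 1%N) ->
  (p ^+ 2 - (codeg v)%:R) * x v = p - (codeg v)%:R.
Proof.
move=> leaf; rewrite mulrBl walk2 -[RHS]addr0 -addrA; congr (_ + _).
apply/eqP; rewrite subr_eq0 -codegE; apply/eqP; apply: eq_bigr => w vw.
rewrite (bigD1 v) 1?coedge_sym //= [X in _ + X]big1 ?addr0 // => u /andP[wu uv].
have : (1 < codeg w)%N.
  apply/card_gt1P; exists u, v; rewrite !inE; split=> //.
  by rewrite coedge_sym.
by rewrite leaf.
Qed.

Hypothesis codeg_gt0 : forall v : G, (0 < codeg v)%N.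
Let delta := #|G|%:R - 1 - p.

Let term_ge0 v : 0 <= ((codeg v)%:R - 1) * x v.
Proof. by rewrite mulr_ge0 // subr_ge0 ler1n. Qed.

Lemma delta_ge0 : 0 <= delta.
Proof. by rewrite /delta -codeg_sum sumr_ge0. Qed.

Lemma delta_ge2 u v : u != v ->
  ((codeg u)%:R - 1) * x u + ((codeg v)%:R - 1) * x v <= delta.
Proof.
move=> uv; rewrite /delta -codeg_sum (bigD1 u) //= (bigD1 v) 1?eq_sym //= addrA.
by rewrite lerDl sumr_ge0.
Qed.

Lemma delta_eq u : (forall v, v != u -> codeg v = 1%N) ->
  delta = ((codeg u)%:R - 1) * x u.
Proof.
move=> leaf; rewrite /delta -codeg_sum (bigD1 u) //= big1 ?addr0 // => v vu.
by rewrite leaf // subrr mul0r.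
Qed.

End PerronVector.

(* The complement of [G] is a star with [a] leaves together with a matching of
   the remaining vertices. *)
Definition star_type (a : nat) (G : sgraph) : Prop :=
  exists2 u : G, codeg u = a & forall v, v != u -> codeg v = 1%N.

(** * Inequalities for the cubic [phi] *)

(** Eliminating X from (a - 1) X = N - 1 - p and (p^2 - a) X = p - a separates a from p, by the
    identity (p^2 - a)(N - 1 - p) - (a - 1)(p - a) = phi N p - (a - 1)(N - 1 - a). *)
Definition phi (R : realFieldType) (N p : R) : R := (N - 1 - p) * (p ^+ 2 - 1).

(** The difference of the two values has the factor q - p. The cofactor is positive because p, q > 3
    and both N - 1 - p and N - 1 - q are below 1. *)
Lemma phi_decr (R : realFieldType) (N p q : R) : 5 <= N ->
  N - 2 < p -> p < q -> q <= N - 1 -> phi N q < phi N p.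
Proof.
move=> N5 Np pq qN; rewrite /phi -subr_gt0.
have -> : (N - 1 - p) * (p ^+ 2 - 1) - (N - 1 - q) * (q ^+ 2 - 1) =
   (q - p) * ((p - 1) * (q - 1) - 2 + p * (1 - (N - 1 - p)) + q * (1 - (N - 1 - q))).
  by ring.
rewrite mulr_gt0 ?subr_gt0 //.
have pq1 : 2 * 2 <= (p - 1) * (q - 1) by apply: ler_pM; lra.
have p0 : 0 <= p * (1 - (N - 1 - p)) by apply: mulr_ge0; lra.
have q0 : 0 <= q * (1 - (N - 1 - q)) by apply: mulr_ge0; lra.
lra.
Qed.

Lemma triple_le_sq (R : realFieldType) (N p : R) : 5 <= N -> N - 2 < p -> 3 * p <= p ^+ 2.
Proof. by move=> N5 Np; rewrite expr2 ler_wpM2r //; lra. Qed.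

(** Here X is the entry at a vertex with d = a. The strict bound on (a - 1) X holds when another
    vertex also contributes to N - 1 - p. *)
Lemma phi_gt (R : realFieldType) (N p X a : R) : 5 <= N -> N - 2 < p ->
  1 <= a <= N - 2 -> (a - 1) * X < N - 1 - p ->
  p - a <= (p ^+ 2 - a) * X -> (a - 1) * (N - 1 - a) < phi N p.
Proof.
move=> N5 Np /andP[a1 aN] dX pX.
have p3 := triple_le_sq N5 Np; have p2 : 0 < p ^+ 2 - a by lra.
have h1 : (p ^+ 2 - a) * ((a - 1) * X) < (p ^+ 2 - a) * (N - 1 - p) by rewrite ltr_pM2l.
have a0 : 0 <= a - 1 by rewrite subr_ge0.
have h2 := ler_wpM2l a0 pX; rewrite /phi; lra.
Qed.

Lemma phi_eq (R : realFieldType) (N p X a : R) : (a - 1) * X = N - 1 - p ->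
  (p ^+ 2 - a) * X = p - a -> phi N p = (a - 1) * (N - 1 - a).
Proof.
move=> dX pX; have h : (p ^+ 2 - a) * (N - 1 - p) = (a - 1) * (p - a) by rewrite -dX -pX; ring.
by rewrite /phi; lra.
Qed.

(** The value 2 (N - 4) is that of a star with 3 or N - 3 leaves. This lemma serves two vertices
    with d = 2, whose entries are X and Y; adding their bounds gives phi N p >= N + p - 5 > 2 N -
    7. *)
Lemma phi_gt_2_2 (R : realFieldType) (N p X Y : R) : 5 <= N -> N - 2 < p ->
  X + Y <= N - 1 - p ->
  p - 2 <= (p ^+ 2 - 2) * X -> p - 2 <= (p ^+ 2 - 2) * Y -> 2 * (N - 4) < phi N p.
Proof.
move=> N5 Np dXY pX pY.
have p3 := triple_le_sq N5 Np; have p2 : 0 <= p ^+ 2 - 2 by lra.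
have h := ler_wpM2l p2 dXY; rewrite /phi; lra.
Qed.

Lemma phi_gt_aux (R : realFieldType) (N p : R) : 5 <= N -> N - 2 < p -> p <= N - 1 ->
  2 * N - 6 - (N - 1 - p) * (N - 3) <= phi N p -> 2 * (N - 4) < phi N p.
Proof.
(* [phi N p <= 2 (N - 4)] would give [(N - 1 - p) (N - 3) < 2]. *)
move=> N5 Np pN h; rewrite ltNge; apply/negP => h2.
have d0 : 0 <= N - 1 - p by rewrite subr_ge0.
have p2 : (N - 1) * (N - 3) <= p ^+ 2 - 1.
  have : (N - 2) * (N - 2) <= p * p by apply: ler_pM; lra.
  by rewrite -expr2; lra.
have := ler_wpM2l d0 p2; rewrite -[(N - 1 - p) * (_ ^+ 2 - 1)]/(phi N p) => h3.
have h4 : ((N - 1 - p) * (N - 3)) * (N - 1) <= 2 * (N - 4) by lra.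
have h5 : (N - 1 - p) * (N - 3) < 2.
  rewrite -(@ltr_pM2r _ (N - 1)); lra.
lra.
Qed.

(** One vertex has d = N - 2 and entry X, another d = 2 and entry Y. The weighted sum of their
    bounds is the hypothesis of [phi_gt_aux]. *)
Lemma phi_gt_max_2 (R : realFieldType) (N p X Y : R) : 5 <= N -> N - 2 < p -> p <= N - 1 ->
  0 <= X -> (N - 3) * X + Y <= N - 1 - p ->
  p - (N - 2) <= (p ^+ 2 - (N - 2)) * X -> p - 2 <= (p ^+ 2 - 2) * Y ->
  2 * (N - 4) < phi N p.
Proof.
move=> N5 Np pN X0 dXY pX pY; apply: phi_gt_aux => //.
(* Weakening the coefficient of X gives both entries the common factor p^2 - 2. *)
have pX2 : p - (N - 2) <= (p ^+ 2 - 2) * X.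
  by apply: le_trans pX _; apply: ler_wpM2r => //; lra.
have p3 := triple_le_sq N5 Np; have p2 : 0 <= p ^+ 2 - 2 by lra.
have N3 : 0 <= N - 3 by lra.
have h1 := ler_wpM2l p2 dXY; have h2 := ler_wpM2l N3 pX2.
by rewrite /phi; lra.
Qed.

Lemma phi_gt_max_max (R : realFieldType) (N p X Y : R) : 5 <= N -> N - 2 < p -> p <= N - 1 ->
  (N - 3) * (X + Y) <= N - 1 - p ->
  p - (N - 2) <= (p ^+ 2 - (N - 2)) * X -> p - (N - 2) <= (p ^+ 2 - (N - 2)) * Y ->
  2 * (N - 4) < phi N p.
Proof.
move=> N5 Np pN dXY pX pY; apply: phi_gt_aux => //.
have p3 := triple_le_sq N5 Np; have p2 : 0 <= p ^+ 2 - (N - 2) by lra.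
have N3 : 0 <= N - 3 by lra.
have h1 := ler_wpM2l p2 dXY; have h2 := ler_wpM2l N3 (lerD pX pY).
by rewrite /phi; lra.
Qed.

(** * Candidates and star types *)

Lemma codeg1_uniq (G : sgraph) (v w w' : G) :
  codeg v = 1%N -> coedge v w -> coedge v w' -> w = w'.
Proof.
move=> /eqP/cards1P[z vE] vw vw'.
have : w \in [set y | coedge v y] by rewrite inE.
have : w' \in [set y | coedge v y] by rewrite inE.
by rewrite vE !inE => /eqP -> /eqP ->.
Qed.

(** The maximum degree gives d >= 1, connectedness excludes isolated vertices and gives d <= n - 2,
    and nonregularity excludes d = 1 throughout. *)
Lemma candidateP n (G : sgraph) : (5 <= n)%N -> candidate n (n - 2) G ->
  [/\ #|G| = n, forall v : G, (0 < codeg v <= n - 2)%N & exists u : G, (1 < codeg u)%N].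
Proof.
move=> n5 [conG nonregG Gn Gmax].
have dle (v : G) : (degree v <= n - 2)%N by rewrite -Gmax /max_degree leq_bigmax.
have dc (v : G) : (degree v + codeg v).+1 = n by rewrite degree_codeg.
have bounds (v : G) : (0 < codeg v <= n - 2)%N.
  suff : (0 < degree v)%N by move: (dle v) (dc v); lia.
  rewrite lt0n; apply/negP => /eqP/cards0_eq dv0.
  have : (1 < #|G|)%N by rewrite Gn; lia.
  rewrite (cardD1 v) inE /= => /card_gt0P[w]; rewrite !inE => /andP[wv _].
  have /connectP[[|z q] /= zq wE] := conG v w; first by rewrite wE eqxx in wv.
  have : z \in [set y | edge v y] by rewrite inE; case/andP: zq.
  by rewrite dv0 inE.
split=> //; have [x [y xy]] := nonregG.
case: (ltnP 1 (codeg x)) => [|x1]; first by exists x.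
exists y; move: (dc x) (dc y) (bounds x) (bounds y); lia.
Qed.

Lemma star_candidate n a (G : sgraph) : (5 <= n)%N -> (2 <= a <= n - 2)%N ->
  #|G| = n -> star_type a G -> candidate n (n - 2) G.
Proof.
move=> n5 an Gn [u ua leaf].
have dc (v : G) : (degree v + codeg v).+1 = n by rewrite degree_codeg.
have [v vu] : exists v, v != u.
  have : (1 < #|G|)%N by rewrite Gn; lia.
  by rewrite (cardD1 u) inE /= => /card_gt0P[w]; rewrite !inE => /andP[wv _]; exists w.
split=> //.
- have [w uw] : exists w, edge u w.
    have /card_gt0P[w] : (0 < degree u)%N by move: (dc u); lia.
    by rewrite inE; exists w.
  have wu : w != u by apply: contraTneq uw => ->; rewrite edge_irrefl.
  have toU z : connect (@edge G) u z.
    have [->|zu] := eqVneq z u; first exact: connect0.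
    have [uz|/negbTE nuz] := boolP (edge u z); first exact: connect1.
    (* A vertex z not adjacent to u has u as its only non-neighbour, so it is adjacent to the
       neighbour w of u. *)
    apply: connect_trans (connect1 uw) _.
    have [->|zw] := eqVneq z w; first exact: connect0.
    apply: connect1; rewrite edgeE eq_sym zw coedge_sym /=; apply/negP => zw'.
    have := @codeg1_uniq _ z w u (leaf z zu) zw'.
    rewrite /coedge zu edge_sym nuz => /(_ isT) wE.
    by rewrite wE eqxx in wu.
  move=> x y; apply: connect_trans (toU y).
  by rewrite (sym_connect_sym (@edge_sym G)).
- by exists u, v; move: (dc u) (dc v) (leaf v vu); lia.
- apply/eqP; rewrite eqn_leq; apply/andP; split.
    apply/bigmax_leqP => z _; have := dc z.
    by have [->|/leaf] := eqVneq z u; [move: (dc u) | ]; lia.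
  have -> : (n - 2)%N = degree v by move: (dc v) (leaf v vu); lia.
  exact: leq_bigmax.
Qed.

(** * Star types are exactly the graphs [Gnt] *)

Lemma isomorphic_codeg (G H : sgraph) (f : G -> H) : bijective f ->
  (forall x y, edge (f x) (f y) = edge x y) -> forall x, codeg (f x) = codeg x.
Proof.
move=> bij_f ef x; rewrite /codeg.
rewrite -(on_card_preimset (f := f) (onW_bij _ bij_f)).
by apply: eq_card => y; rewrite !inE /coedge ef (inj_eq (bij_inj bij_f)).
Qed.

Lemma isomorphic_star a (G H : sgraph) : isomorphic G H -> star_type a H -> star_type a G.
Proof.
move=> [f bij_f ef] [u ua leaf]; have [g fK gK] := bij_f.
have cf := isomorphic_codeg bij_f ef.
exists (g u) => [|v vu]; first by rewrite -cf gK.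
by rewrite -cf leaf // -(can_eq gK) fK.
Qed.

Lemma card_Gnt n t : (t < n)%N -> #|Gnt n t| = n.
Proof. by move=> tn; rewrite !card_sum card_unit !card_ord; lia. Qed.

Lemma Gnt_star n t : (t < n)%N -> ~~ odd t -> star_type (n - t - 1) (Gnt n t).
Proof.
move=> tn t_even; exists (inl (inl tt)).
  have inr_inj : injective (fun j : 'I_(n - t - 1) => inr j : Gnt n t) by move=> j k [].
  rewrite -[RHS]card_ord -(card_codom inr_inj) /codeg cardsE.
  apply: eq_card => -[[[]|i]|j] /=; rewrite unfold_in /coedge /=.
  - by apply/esym/codomP => -[].
  - by apply/esym/codomP => -[].
  - by apply/esym/codomP; exists j.
case=> [[[]|i]|j] // _; apply/eqP/cards1P; last first.
  exists (inl (inl tt)); apply/setP => -[[[]|k]|k]; rewrite !inE /coedge //=.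
  by rewrite negbK -[inr _ == _]/(j == k) andNb.
(* This is the partner of i in the matching {0,1}, {2,3}, ...; for even i it stays below t because t
   is even. *)
have it : ((if odd i then i.-1 else i.+1) < t)%N by have := ltn_ord i; case: ifP; lia.
exists (inl (inr (Ordinal it))); apply/setP => -[[[]|k]|k]; rewrite !inE /coedge //=.
rewrite -![inl (inr _) == _ :> Gnt n t]/(_ == _ :> 'I_t) -!val_eqE /= /matching_edge.
rewrite -!val_eqE /=; case: ifP; lia.
Qed.

(** The orbits of a fixed-point-free involution are pairs; listing them one after the other puts
    partners at positions 2k and 2k + 1, as in [matching_edge]. *)
Lemma matching_seq (T : finType) (f : T -> T) (A : {set T}) :
  (forall x, x \in A -> [/\ f x \in A, f x != x & f (f x) = x]) ->
  exists s : seq T, [/\ uniq s, s =i A, ~~ odd (size s) &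
    forall x0 i j, (i < size s)%N -> (j < size s)%N ->
      (f (nth x0 s i) == nth x0 s j) = (i != j) && (i./2 == j./2)].
Proof.
have [m] := ubnP #|A|; elim: m A => // m IHm A Am fA.
have [->|[x xA]] := set_0Vmem A.
  by exists [::]; split=> [||//|x0 [|i] j] // x; rewrite !inE.
have [fxA fxx ffx] := fA x xA; pose B := A :\ x :\ f x.
have Bm : (#|B| < m)%N.
  rewrite -ltnS; apply: leq_trans Am; rewrite ltnS.
  apply: proper_card; apply: sub_proper_trans (properD1 xA); exact: subD1set.
have fB y : y \in B -> [/\ f y \in B, f y != y & f (f y) = y].
  rewrite !inE => /and3P[yfx yx yA]; have [fyA fyy ffy] := fA y yA.
  split=> //; rewrite fyA andbT; apply/andP; split.
    by apply: contraNneq yx => fyfx; rewrite -ffy fyfx ffx.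
  by apply: contraNneq yfx => <-; rewrite ffy.
have [s [s_uniq sB s_even sE]] := IHm B Bm fB.
exists (x :: f x :: s); split.
- by rewrite /= s_uniq inE !sB !inE !eqxx /= andbF eq_sym (negbTE fxx).
- move=> y; rewrite !inE sB !inE.
  have [->|] := eqVneq y x; first by rewrite xA.
  by have [->|] := eqVneq y (f x); first by rewrite fxA.
- by rewrite /= negbK.
- have sN x0 i : (i < size s)%N ->
    [/\ nth x0 s i != x, nth x0 s i != f x, f (nth x0 s i) != x & f (nth x0 s i) != f x].
    move=> /(mem_nth x0); rewrite sB => iB; have [fiB _ _] := fB _ iB.
    by move: iB fiB; rewrite !inE => /and3P[-> -> _] /and3P[-> -> _].
  move=> x0 [|[|i]] [|[|j]] //= si sj.
  + by rewrite (negbTE fxx).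
  + by rewrite eqxx.
  + by have [_ /negbTE + _ _] := sN x0 j sj; rewrite eq_sym.
  + by rewrite ffx eqxx.
  + by rewrite ffx eq_sym (negbTE fxx).
  + by have [/negbTE + _ _ _] := sN x0 j sj; rewrite ffx eq_sym.
  + by have [_ _ /negbTE -> _] := sN x0 i si.
  + by have [_ _ _ /negbTE ->] := sN x0 i si.
  + by rewrite sE // !eqSS.
Qed.

(** The non-neighbours [L] of the centre form the clique, and on the remaining set [A] the
    complement is a perfect matching, which [matching_seq] enumerates. *)
Lemma star_isomorphic n a (G : sgraph) : #|G| = n -> star_type a G ->
  ~~ odd (n - a - 1) /\ isomorphic G (Gnt n (n - a - 1)).
Proof.
move=> Gn [u ua leaf]; pose L := [set v | coedge u v].
pose A := [set v | (v != u) && ~~ coedge u v].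
have uL : u \notin L by rewrite inE /coedge eqxx.
have La : #|L| = a by rewrite -ua.
have AE : A = ~: (u |: L) by apply/setP => v; rewrite !inE negb_or.
have An : #|A| = (n - a - 1)%N.
  by have := cardsC (u |: L); rewrite -AE cardsU1 uL La Gn; lia.
have an : (a < n)%N.
  by have := max_card [in u |: L]; rewrite cardsU1 uL La Gn.
(* For v != u this is the unique non-neighbour of v; the default [u] is never reached there. *)
pose f v := odflt u [pick w | coedge v w].
have fP v w : v != u -> coedge v w = (f v == w).
  move=> vu; have v1 := leaf v vu; rewrite /f; case: pickP => [z vz|no] /=.
    apply/idP/eqP => [vw|<- //]; exact: codeg1_uniq v1 vz vw.
  have : (0 < codeg v)%N by rewrite v1.
  by case/card_gt0P => z; rewrite inE no.
have fA v : v \in A -> [/\ f v \in A, f v != v & f (f v) = v].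
  rewrite inE => /andP[vu uv]; have vfv : coedge v (f v) by rewrite fP.
  have fvu : f v != u by apply: contraNneq uv => <-; rewrite coedge_sym.
  have ffv : f (f v) = v by apply/eqP; rewrite -fP // coedge_sym.
  split=> //; last by rewrite eq_sym; case/andP: vfv.
  rewrite inE fvu coedge_sym fP // ffv; exact: vu.
have [s [s_uniq sA s_even sE]] := matching_seq fA.
have ss : size s = (n - a - 1)%N by rewrite -An -(card_uniqP s_uniq) (eq_card sA).
split; first by rewrite -ss.
set t := (n - a - 1)%N in ss *.
have aE : (n - t - 1)%N = a by rewrite /t; lia.
have sL : size (enum L) = (n - t - 1)%N by rewrite -cardE La aE.
pose h (x : Gnt n t) : G := match x with
  | inl (inl _) => u | inl (inr i) => nth u s i | inr j => nth u (enum L) j end.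
have hA (i : 'I_t) : (nth u s i != u) && ~~ coedge u (nth u s i).
  have : nth u s i \in A by rewrite -sA mem_nth // ss.
  by rewrite inE.
have hL (j : 'I_(n - t - 1)) : coedge u (nth u (enum L) j).
  have : nth u (enum L) j \in L by rewrite -mem_enum mem_nth // sL.
  by rewrite inE.
have hLu (j : 'I_(n - t - 1)) : nth u (enum L) j != u.
  by have /andP[+ _] := hL j; rewrite eq_sym.
have hLP (j : 'I_(n - t - 1)) v : coedge (nth u (enum L) j) v = (u == v).
  apply/idP/eqP => [jv|<-]; last by rewrite coedge_sym hL.
  by apply: codeg1_uniq (leaf _ (hLu j)) _ jv; rewrite coedge_sym hL.
have AL (i : 'I_t) (j : 'I_(n - t - 1)) : nth u s i != nth u (enum L) j.
  by have /andP[_] := hA i; apply: contraNneq => ->; exact: hL.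
have h_inj : injective h.
  move=> [[[]|i]|i] [[[]|j]|j] //= hE.
  - by have := hA j; rewrite -hE eqxx.
  - by have := hLu j; rewrite -hE eqxx.
  - by have := hA i; rewrite hE eqxx.
  - congr (inl (inr _)); apply/val_inj/eqP; rewrite -(nth_uniq u _ _ s_uniq) ?ss;
      [exact/eqP | exact: ltn_ord | exact: ltn_ord].
  - by have := AL i j; rewrite hE eqxx.
  - by have := hLu i; rewrite hE eqxx.
  - by have := AL j i; rewrite hE eqxx.
  - congr inr; apply/val_inj/eqP; rewrite -(nth_uniq u _ _ (enum_uniq L)) ?sL;
      [exact/eqP | exact: ltn_ord | exact: ltn_ord].
have h_edge x y : edge (h x) (h y) = edge x y.
  rewrite edgeE (inj_eq h_inj).
  case: x y => [[[]|i]|i] [[[]|j]|j] //=.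
  - by have /andP[_ ->] := hA j.
  - by rewrite hL.
  - by rewrite coedge_sym; have /andP[_ ->] := hA i.
  - have /andP[iu _] := hA i; rewrite fP // sE ?ss; try exact: ltn_ord.
    by rewrite /matching_edge -!val_eqE.
  - by rewrite coedge_sym hLP eq_sym; have /andP[-> _] := hA i.
  - by rewrite coedge_sym hL.
  - by rewrite hLP eq_sym; have /andP[-> _] := hA j.
  - by rewrite hLP [u == _]eq_sym hLu andbT.
have [|g gK hK] := inj_card_bij h_inj.
  by rewrite [#|Gnt n t|]card_Gnt ?Gn // /t; lia.
by exists g => [|x y]; [exists h | rewrite -h_edge !hK].
Qed.

(** * Comparison of spectral radii *)

Lemma perron_coedge (R : realType) (G : sgraph) : (0 < #|G|)%N ->
  exists x : G -> R, [/\ forall v, 0 <= x v, \sum_v x v = 1 &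
    forall v, (spectral_radius R G + 1) * x v + \sum_(w | coedge v w) x w = 1].
Proof.
move=> /(perron R)[x [x_ge0 x_sum xE]]; exists x; split=> // v.
rewrite mulrDl mul1r xE -[RHS]x_sum [RHS](bigD1 v) //= [RHS]addrC addrAC; congr (_ + _).
rewrite [RHS](bigID (edge v)) /=; congr (_ + _); apply: eq_bigl => w.
  by case: eqVneq => [->|]; rewrite ?edge_irrefl.
by rewrite /coedge eq_sym.
Qed.

Lemma ler_natB (R : numDomainType) (a b n : nat) :
  (b <= n)%N -> (a <= n - b)%N -> a%:R <= n%:R - b%:R :> R.
Proof. by move=> bn an; rewrite -natrB // ler_nat. Qed.

Section Extremal.
Variables (R : realType) (n : nat).
Hypothesis n_ge5 : (5 <= n)%N.
Let n5 : 5 <= n%:R :> R. Proof. by rewrite (ler_nat R 5). Qed.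

(* Number of leaves of the star in the complement of an extremal graph, and
   the corresponding value [(a - 1) (n - 1 - a)] of [phi]. *)
Definition optimal_star (a : nat) : bool :=
  if odd n then a == 2 else (a == 3) || (a == n - 3)%N.

Definition optimal_phi : R := if odd n then n%:R - 3 else 2 * (n%:R - 4).

Lemma optimal_star_bounds a : optimal_star a -> (2 <= a <= n - 3)%N.
Proof.
rewrite /optimal_star; case: ifP => n_odd; first by move=> /eqP ->; lia.
by move=> /orP[] /eqP ->; lia.
Qed.

Lemma optimal_starE a : optimal_star a ->
  (a%:R - 1) * (n%:R - 1 - a%:R) = optimal_phi.
Proof.
rewrite /optimal_star /optimal_phi; case: ifP => n_odd; first by move=> /eqP ->; lra.
move=> /orP[] /eqP ->; first by lra.
by rewrite natrB; [lra | lia].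
Qed.

(** Parity leaves only a between 3 and n - 3 for odd n, and between 4 and n - 4 for even n. There
    the concave function (a - 1)(n - 1 - a) is at least its value at the ends, which exceeds
    [optimal_phi]. *)
Lemma optimal_phi_lt a : (2 <= a <= n - 2)%N -> ~~ optimal_star a ->
  ~~ odd (n - a - 1) -> optimal_phi < (a%:R - 1) * (n%:R - 1 - a%:R).
Proof.
rewrite /optimal_star /optimal_phi; case: ifP => n_odd an a_nopt a_par.
  have {}an : (3 <= a <= n - 3)%N by lia.
  have a3 : 3 <= a%:R :> R by rewrite (ler_nat R 3); lia.
  have aN : a%:R <= n%:R - 3 :> R by apply: (@ler_natB _ _ 3); lia.
  have : 0 <= (a%:R - 3) * (n%:R - 3 - a%:R) :> R by apply: mulr_ge0; lra.
  lra.
have {}an : (4 <= a <= n - 4)%N by lia.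
have a4 : 4 <= a%:R :> R by rewrite (ler_nat R 4); lia.
have aN : a%:R <= n%:R - 4 :> R by apply: (@ler_natB _ _ 4); lia.
have : 0 <= (a%:R - 4) * (n%:R - 4 - a%:R) :> R by apply: mulr_ge0; lra.
lra.
Qed.

Local Notation pr G := (spectral_radius R G + 1).

Lemma star_spectral a (G : sgraph) : #|G| = n -> (2 <= a <= n - 2)%N ->
  star_type a G ->
  n%:R - 2 < pr G /\ phi n%:R (pr G) = (a%:R - 1) * (n%:R - 1 - a%:R).
Proof.
move=> Gn an stG; have [u ua leaf] := stG; have G_gt0 : (0 < #|G|)%N by rewrite Gn; lia.
split.
  have := degree_sum_le R G_gt0; rewrite Gn.
  have : (\sum_(v : G) degree v + \sum_(v : G) codeg v = n * (n - 1))%N.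
    rewrite -big_split /= (eq_bigr (fun _ => n - 1)%N) => [|v _].
      by rewrite sum_nat_const; congr (_ * _)%N.
    by have := degree_codeg v; rewrite Gn; lia.
  have -> : (\sum_(v : G) codeg v = a + (n - 1))%N.
    rewrite (bigD1 u) //= ua (eq_bigr (fun _ => 1%N)) //; congr (_ + _)%N.
    by rewrite sum1_card cardC1 Gn subn1.
  move: (\sum_v _)%N => D h2 DE.
  (* Here D = n (n - 1) - (n - 1) - a, so the average degree exceeds n - 3. *)
  have : (n * n - 3 * n < D)%N by nia.
  rewrite -(ltr_nat R) natrB ?leq_mul2r; last by lia.
  rewrite !natrM => h1.
  have n_gt0 : 0 < n%:R :> R by rewrite ltr0n; lia.
  rewrite -(ltr_pM2r n_gt0); lra.
have [x [x_ge0 x_sum xE]] := perron_coedge R G_gt0.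
apply: (@phi_eq _ _ _ (x u)).
  by rewrite -Gn -ua -(delta_eq x_sum xE leaf).
rewrite -ua; apply: walk2_eq xE _ _ => w uw; apply: leaf.
by apply: contraTneq uw => ->; rewrite /coedge eqxx.
Qed.

(** The bound p > n - 2, which every star type satisfies, restricts the comparison to the range
    where [phi] decreases. Either two vertices have d >= 2, or the complement is a star plus a
    matching. *)
Lemma candidate_spectral (H : sgraph) : candidate n (n - 2) H -> n%:R - 2 < pr H ->
  pr H <= n%:R - 1 /\
  ((exists2 a, optimal_star a & star_type a H) \/ optimal_phi < phi n%:R (pr H)).
Proof.
move=> candH Np; have [Hn cb [u u1]] := candidateP n_ge5 candH.
have H_gt0 : (0 < #|H|)%N by rewrite Hn; lia.
have [x [x_ge0 x_sum xE]] := perron_coedge R H_gt0.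
have cb0 (v : H) : (0 < codeg v)%N by case/andP: (cb v).
have cR (v : H) : ((1 : R) <= (codeg v)%:R) && ((codeg v)%:R <= (n%:R - 2 : R)).
  rewrite ler1n cb0 /=; apply: (@ler_natB _ _ 2); first by lia.
  by case/andP: (cb v).
have pN : pr H <= n%:R - 1 by rewrite -subr_ge0 -Hn; apply: delta_ge0 x_ge0 x_sum xE cb0.
split=> //; have wge v := walk2_ge x_ge0 xE v.
have d2 v w : v != w -> ((codeg v)%:R - 1) * x v + ((codeg w)%:R - 1) * x w <=
    n%:R - 1 - pr H.
  by move=> vw; rewrite -Hn; apply: delta_ge2 vw.
have [[w wu w1]|leaf] : (exists2 w, w != u & (1 < codeg w)%N) \/
    forall w, w != u -> codeg w = 1%N.
  case: (pickP [pred w | (w != u) && (1 < codeg w)%N]) => [w /andP[]|no]; first by left; exists w.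
  right=> w wu; have := no w; rewrite /= wu /= => /negbT; have := cb0 w; lia.
- right.
  have strict (v z : H) : v != z -> (1 < codeg v)%N -> (1 < codeg z)%N ->
      ((codeg v)%:R - 1) * ((n%:R - 1) - (codeg v)%:R) < phi n%:R (pr H).
    move=> vz v1 z1; apply: (phi_gt n5 Np (cR v) _ (wge v)).
    apply: lt_le_trans (d2 v z vz); rewrite ltrDl mulr_gt0 ?subr_gt0 ?ltr1n //.
    have N5 := n5; have p3 := triple_le_sq n5 Np; have := wge z; have /andP[z1R zN] := cR z.
    (* The entry at z is positive: x(z) = 0 in [walk2_ge] would give p <= d(z) <= n - 2. *)
    rewrite lt_neqAle x_ge0 andbT; apply: contraTneq => <-.
    by rewrite mulr0 -ltNge; lra.
  rewrite /optimal_phi; case: ifP => n_odd.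
    apply: le_lt_trans (strict u w _ u1 w1); last by rewrite eq_sym.
    have /andP[_ uN] := cR u; have u2 : 2 <= (codeg u)%:R :> R by rewrite (ler_nat R 2).
    have : 0 <= ((codeg u)%:R - 2) * (n%:R - 2 - (codeg u)%:R) :> R by apply: mulr_ge0; lra.
    lra.
  (* For even n the single-vertex bound suffices when 3 <= d(v) <= n - 3; the values 2 and n - 2 are
     left to the two-vertex estimates. *)
  have mid (v z : H) : v != z -> (1 < codeg v)%N -> (1 < codeg z)%N ->
      optimal_phi < phi n%:R (pr H) \/ codeg v = 2 \/ codeg v = (n - 2)%N.
    move=> vz v1 z1.
    have [v2|v2] := eqVneq (codeg v) 2; first by right; left.
    have [vn|vn] := eqVneq (codeg v) (n - 2)%N; first by right; right.
    left; apply: le_lt_trans (strict v z vz v1 z1); rewrite /optimal_phi n_odd.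
    have vb := cb v.
    have v3 : 3 <= (codeg v)%:R :> R by rewrite (ler_nat R 3); lia.
    have vN : (codeg v)%:R <= n%:R - 3 :> R.
      by apply: (@ler_natB _ _ 3); lia.
    have : 0 <= ((codeg v)%:R - 3) * (n%:R - 3 - (codeg v)%:R) :> R by apply: mulr_ge0; lra.
    lra.
  have n2 : (n - 2)%:R = n%:R - 2 :> R by rewrite natrB //; lia.
  have uw : u != w by rewrite eq_sym.
  have := mid u w uw u1 w1; rewrite /optimal_phi n_odd => -[//|uE].
  have := mid w u wu w1 u1; rewrite /optimal_phi n_odd => -[//|wE].
  have := wge u; have := wge w; have := d2 u w uw.
  case: uE => ->; case: wE => ->; rewrite ?n2 => dd ww wu'.
  + by apply: (@phi_gt_2_2 _ _ _ (x u) (x w)) => //; lra.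
  + by apply: (@phi_gt_max_2 _ _ _ (x w) (x u)) => //; lra.
  + by apply: (@phi_gt_max_2 _ _ _ (x u) (x w)) => //; lra.
  + by apply: (@phi_gt_max_max _ _ _ (x u) (x w)) => //; lra.
have stH : star_type (codeg u) H by exists u.
have [par _] := star_isomorphic Hn stH.
have an : (2 <= codeg u <= n - 2)%N by have := cb u; lia.
have [opt|nopt] := boolP (optimal_star (codeg u)); first by left; exists (codeg u).
by right; have [_ ->] := star_spectral Hn an stH; apply: optimal_phi_lt.
Qed.

Lemma optimal_star_spectral a (G : sgraph) : #|G| = n -> optimal_star a ->
  star_type a G -> n%:R - 2 < pr G /\ phi n%:R (pr G) = optimal_phi.
Proof.
move=> Gn opt stG; rewrite -(optimal_starE opt); apply: star_spectral => //.
have := optimal_star_bounds opt; lia.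
Qed.

(** A candidate of larger spectral radius would have a smaller [phi], whereas [candidate_spectral]
    makes its [phi] at least [optimal_phi]. *)
Lemma optimal_star_extremal a (G : sgraph) : #|G| = n -> optimal_star a ->
  star_type a G -> extremal R n (n - 2) G.
Proof.
move=> Gn opt stG; have [Np pE] := optimal_star_spectral Gn opt stG.
split=> [|H candH].
  by apply: star_candidate stG => //; have := optimal_star_bounds opt; lia.
rewrite leNgt; apply/negP => lt_GH.
have pGH : pr G < pr H by rewrite ltrD2r.
have [pN [[b optb stH]|]] := candidate_spectral candH (lt_trans Np pGH).
  have [Hn _ _] := candidateP n_ge5 candH.
  have [_ pHE] := optimal_star_spectral Hn optb stH.
  by have := phi_decr n5 Np pGH pN; rewrite pE pHE ltxx.
by rewrite -pE => /(lt_trans (phi_decr n5 Np pGH pN)); rewrite ltxx.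
Qed.

(** Comparison with the optimal graph [T] puts [G] in the range p > n - 2 and bounds its [phi] by
    [optimal_phi], so only the star alternative of [candidate_spectral] survives. *)
Lemma extremal_optimal_star (G T : sgraph) a : extremal R n (n - 2) G ->
  #|T| = n -> optimal_star a -> star_type a T ->
  exists2 b, optimal_star b & star_type b G.
Proof.
move=> [candG maxG] Tn opt stT; have [Np pE] := optimal_star_spectral Tn opt stT.
have [candT _] := optimal_star_extremal Tn opt stT.
have pTG : pr T <= pr G by rewrite lerD2r maxG.
have [pN [//|]] := candidate_spectral candG (lt_le_trans Np pTG).
move: pTG; rewrite le_eqVlt => /orP[/eqP <-|pTG]; first by rewrite pE ltxx.
by rewrite -pE => /(lt_trans (phi_decr n5 Np pTG pN)); rewrite ltxx.
Qed.

End Extremal.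

Theorem theorem1p1 (R : realType) (n : nat) (hn : (5 <= n)%N) (G : sgraph) :
  extremal R n (n - 2) G <->
  (if odd n then isomorphic G (Gnt n (n - 3))
   else isomorphic G (Gnt n (n - 4)) \/ isomorphic G (Gnt n 2)).
Proof.
have iso_opt a t : t = (n - a - 1)%N -> (a < n)%N -> ~~ odd t -> optimal_star n a ->
    isomorphic G (Gnt n t) -> extremal R n (n - 2) G.
  move=> tE an t_even opt GT; have tn : (t < n)%N by lia.
  have Gn : #|G| = n.
    by have [f bij_f _] := GT; rewrite (bij_eq_card bij_f) card_Gnt.
  apply: (optimal_star_extremal R hn Gn opt); apply: isomorphic_star GT _.
  have -> : a = (n - t - 1)%N by lia.
  exact: Gnt_star.
(* The numbers b and t only provide [Gnt n t] as an optimal graph for comparison; the number a of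
   leaves for [G] may differ from b. *)
have opt_iso b t : t = (n - b - 1)%N -> (b < n)%N -> ~~ odd t -> optimal_star n b ->
    extremal R n (n - 2) G -> exists2 a, optimal_star n a & isomorphic G (Gnt n (n - a - 1)).
  move=> tE bn t_even opt exG; have tn : (t < n)%N by lia.
  have stT : star_type b (Gnt n t).
    by have := Gnt_star tn t_even; have -> : (n - t - 1)%N = b by lia.
  have [a opta stG] := extremal_optimal_star hn exG (card_Gnt tn) opt stT.
  have [[_ _ Gn _] _] := exG.
  by have [_ isoG] := star_isomorphic Gn stG; exists a.
case: ifP => n_odd; split.
- move=> /(opt_iso 2 (n - 3)%N)[]; rewrite /optimal_star ?n_odd //; try lia.
  by move=> a /eqP ->; have -> : (n - 2 - 1 = n - 3)%N by lia.
- by apply: (iso_opt 2); rewrite /optimal_star ?n_odd //; lia.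
- move=> /(opt_iso 3 (n - 4)%N)[]; rewrite /optimal_star ?n_odd //; try lia.
  move=> a /orP[] /eqP ->.
    by rewrite (_ : n - 3 - 1 = n - 4)%N; [left | lia].
  by rewrite (_ : n - (n - 3) - 1 = 2)%N; [right | lia].
- case; [apply: (iso_opt 3) | apply: (iso_opt (n - 3)%N)];
    rewrite /optimal_star ?n_odd ?eqxx ?orbT //; lia.
Qed.
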